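(* $\mathrm C^*_{\rm e}(\mathcal O_{{\rm spin}(\aleph_0)})\cong \mathrm C^*_{\rm e}(\overline{\mathcal O_{{\rm spin}(\aleph_0)}})\cong\bigotimes_1^\infty \mathrm M_2(\mathbb C)$.
   Context: $\mathcal A_{{\rm spin}(\aleph_0)}$ is the universal unital C$^*$-algebra generated by a sequence $\{\mathfrak u_k\}_{k\in\mathbb N}$ subject to the relations $\mathfrak u_k^*=\mathfrak u_k$, $\mathfrak u_k^2=1$ for all $k$, and $\mathfrak u_i\mathfrak u_j+\mathfrak u_j\mathfrak u_i=0$ for all $i\ne j$. $\mathcal O_{{\rm spin}(\aleph_0)}=\mathrm{Span}\{1,\mathfrak u_k: k\in\mathbb N\}\subseteq\mathcal A_{{\rm spin}(\aleph_0)}$, and $\overline{\mathcal O_{{\rm spin}(\aleph_0)}}$ is its norm-closure in $\mathcal A_{{\rm spin}(\aleph_0)}$. $\bigotimes_1^\infty \mathrm M_2(\mathbb C)$ is the infinite C$^*$-tensor product (the CAR algebra, i.e. the UHF algebra of type $2^\infty$). An operator system is a unital $*$-closed linear subspace $\mathcal R$ of a unital C$^*$-algebra $\mathcal B$; $\mathrm M_n(\mathcal R)_+$ denotes the elements of $\mathrm M_n(\mathcal R)$ positive in $\mathrm M_n(\mathcal B)$. A unital complete order embedding is a unital injective linear map $\phi:\mathcal R\to\mathcal T$ of operator systems such that, for all $n\in\mathbb N$ and $X\in \mathrm M_n(\mathcal R)$, the entrywise image $\phi^{(n)}(X)$ is in $\mathrm M_n(\mathcal T)_+$ if and only if $X\in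 \mathrm M_n(\mathcal R)_+$. The C$^*$-envelope $\mathrm C^*_{\rm e}(\mathcal R)$ of an operator system $\mathcal R$ is the (unique up to isomorphism) unital C$^*$-algebra $\mathcal A_{\rm e}$ for which there is a unital complete order embedding $\iota_{\rm e}:\mathcal R\to\mathcal A_{\rm e}$ such that $\iota_{\rm e}(\mathcal R)$ generates $\mathcal A_{\rm e}$ as a C$^*$-algebra and, for every unital complete order embedding $\phi:\mathcal R\to\mathcal A$ into a unital C$^*$-algebra $\mathcal A$ such that $\phi(\mathcal R)$ generates $\mathcal A$, there is a surjective $*$-homomorphism $\pi:\mathcal A\to\mathcal A_{\rm e}$ with $\iota_{\rm e}=\pi\circ\phi$. The symbol $\cong$ denotes isomorphism of C$^*$-algebras. *)

(* Defs.v *)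
From HB Require Import structures.
From mathcomp Require Import all_boot all_order all_algebra.
From mathcomp Require Import all_classical all_reals all_analysis.
From mathcomp Require Import complex mxtens.

Set Implicit Arguments.
Unset Strict Implicit.
Unset Printing Implicit Defensive.

Import Order.TTheory GRing.Theory Num.Theory.
Import numFieldNormedType.Exports.

Local Open Scope classical_set_scope.
Local Open Scope ring_scope.

(* Unital C*-algebras over K, to be used with K := R[i].  The norm is the one
   of the normed module structure: it takes its values in K, and these are
   nonnegative, hence real.  The zero algebra is excluded.  The product is a
   field of the mixin, and the algebra structure is derived from it below,
   because a structure inheriting from both [GRing.Algebra] and [NormedModule]
   would have to be declared before [Num.NumDomain]. *)
HB.mixin Record isCStarAlgebra (K : numClosedFieldType) A
    of CompleteNormedModule K A := {
  csone : A;
  csmul : A -> A -> A;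
  csmulA : associative csmul;
  csmul1l : left_id csone csmul;
  csmul1r : right_id csone csmul;
  csmulDl : left_distributive csmul +%R;
  csmulDr : right_distributive csmul +%R;
  csone_neq0 : csone != 0;
  csscaleAl : forall (a : K) (x y : A), a *: csmul x y = csmul (a *: x) y;
  csscaleAr : forall (a : K) (x y : A), a *: csmul x y = csmul x (a *: y);
  star : A -> A;
  starK : involutive star;
  starD : {morph star : x y / x + y};
  starZ : forall (a : K) (x : A), star (a *: x) = a^* *: star x;
  csstarM : forall x y : A, star (csmul x y) = csmul (star y) (star x);
  csnormM : forall x y : A, `|csmul x y| <= `|x| * `|y|;
  csnorm_star : forall x : A, `|csmul (star x) x| = `|x| ^+ 2
}.

#[short(type="cstarAlgType")]
HB.structure Definition CStarAlgebra (K : numClosedFieldType) :=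
  {A of isCStarAlgebra K A & CompleteNormedModule K A}.

HB.instance Definition _ (K : numClosedFieldType) (A : cstarAlgType K) :=
  GRing.Zmodule_isNzRing.Build A
    csmulA csmul1l csmul1r csmulDl csmulDr csone_neq0.
HB.instance Definition _ (K : numClosedFieldType) (A : cstarAlgType K) :=
  GRing.Lmodule_isLalgebra.Build K A csscaleAl.
HB.instance Definition _ (K : numClosedFieldType) (A : cstarAlgType K) :=
  GRing.Lalgebra_isAlgebra.Build K A csscaleAr.

Section CStarAlgebras.
Context {K : numClosedFieldType}.
Implicit Types A B : cstarAlgType K.

Definition starhom A B (f : {lrmorphism A -> B}) : Prop :=
  forall x, f (star x) = star (f x).

Definition cstar_isomorphic A B : Prop :=
  exists2 f : {lrmorphism A -> B}, starhom f & bijective f.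

Definition cstar_subalgebra A (D : set A) : Prop :=
  [/\ closed D, D 1,
      forall (a : K) x y, D x -> D y -> D (a *: x + y),
      forall x y, D x -> D y -> D (x * y)
    & forall x, D x -> D (star x)].

Definition cstar_generates A (S : set A) : Prop :=
  forall D : set A, cstar_subalgebra D -> S `<=` D -> D = setT.

Definition lin_span A (S : set A) : set A :=
  [set x | exists n (a : 'I_n -> K) (v : 'I_n -> A),
     (forall i, S (v i)) /\ x = \sum_(i < n) a i *: v i].

Definition operator_system A (S : set A) : Prop :=
  [/\ S 1, forall (a : K) x y, S x -> S y -> S (a *: x + y)
    & forall x, S x -> S (star x)].

Definition adjmx A n (X : 'M[A]_n) : 'M[A]_n := \matrix_(i, j) star (X j i).

(* Positivity in the C*-algebra M_n(A); it involves the *-algebra structure of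
   M_n(A) only, and not its C*-norm. *)
Definition mx_positive A n (X : 'M[A]_n) : Prop :=
  exists Y : 'M[A]_n, X = adjmx Y *m Y.

(* Unital complete order embeddings of the operator system S of A into the
   operator system B; the values of phi outside S are irrelevant. *)
Definition complete_order_embedding A B (S : set A) (phi : A -> B) : Prop :=
  [/\ phi 1 = 1,
      forall (a : K) x y, S x -> S y -> phi (a *: x + y) = a *: phi x + phi y,
      forall x y, S x -> S y -> phi x = phi y -> x = y
    & forall n (X : 'M[A]_n), (forall i j, S (X i j)) ->
        mx_positive (map_mx phi X) <-> mx_positive X].

(* (E, iota) is the C*-envelope of the operator system S of A. *)
Definition cstar_envelope A (S : set A) (E : cstarAlgType K) (iota : A -> E) :
    Prop :=
  [/\ complete_order_embedding S iota,
      cstar_generates (iota @` S)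
    & forall B (phi : A -> B),
        complete_order_embedding S phi -> cstar_generates (phi @` S) ->
        exists pi : {lrmorphism B -> E},
          [/\ starhom pi, forall e, exists b, pi b = e
            & forall x, S x -> iota x = pi (phi x)]].

Definition spin_relations A (u : nat -> A) : Prop :=
  [/\ forall k, star (u k) = u k, forall k, u k ^+ 2 = 1
    & forall i j, i != j -> u i * u j + u j * u i = 0].

Definition universal_spin_algebra A (u : nat -> A) : Prop :=
  [/\ spin_relations u, cstar_generates (range u)
    & forall B (v : nat -> B), spin_relations v ->
        exists2 f : {lrmorphism A -> B}, starhom f & forall k, f (u k) = v k].

Definition spin_system A (u : nat -> A) : set A := lin_span (1 |` range u).

(* 2 ^ n, with [tdim n.+1] convertible to [tdim n * 2] so that the n-fold
   tensor power of M_2 is 'M_(tdim n), and a |-> a (x) 1 needs no cast. *)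
Fixpoint tdim (n : nat) : nat := if n is m.+1 then (tdim m * 2)%N else 1%N.

Definition mx_starhom A n (f : 'M[K]_n -> A) : Prop :=
  [/\ f 1%:M = 1,
      forall (a : K) X Y, f (a *: X + Y) = a *: f X + f Y,
      forall X Y, f (X *m Y) = f X * f Y
    & forall X, f (map_mx Num.conj X^T) = star (f X)].

(* T is the C*-algebraic inductive limit of the n-fold tensor powers of M_2
   along a |-> a (x) 1, i.e. the completion of their union.  No norm on
   the matrix algebras is needed, as injective *-homomorphisms between
   C*-algebras are isometric. *)
Definition infinite_tensor_M2 (T : cstarAlgType K) : Prop :=
  exists j : forall n, 'M[K]_(tdim n) -> T,
    [/\ forall n, mx_starhom (j n), forall n, injective (j n),
        forall n (X : 'M[K]_(tdim n)), j n.+1 (X *t (1%:M : 'M[K]_2)) = j n X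
      & closure (\bigcup_n range (j n)) = setT].

Lemma starM A (x y : A) : star (x * y) = star y * star x.
Proof. exact: csstarM. Qed.

Lemma cstar_normM A (x y : A) : `|x * y| <= `|x| * `|y|.
Proof. exact: csnormM. Qed.

Lemma cstar_norm A (x : A) : `|star x * x| = `|x| ^+ 2.
Proof. exact: csnorm_star. Qed.

Lemma star_norm A (x : A) : `|star x| = `|x|.
Proof.
have le_star (y : A) : `|y| <= `|star y|.
  have [->|y0] := eqVneq y 0; first by rewrite normr0.
  have := cstar_normM (star y) y.
  by rewrite cstar_norm expr2 ler_pM2r // normr_gt0.
by apply/eqP; rewrite eq_le le_star -{2}(starK x) le_star.
Qed.

Lemma lin_span_sub A (S : set A) : S `<=` lin_span S.
Proof.
move=> x Sx; exists 1%N, (fun=> 1), (fun=> x).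
by split=> //; rewrite big_ord1 scale1r.
Qed.

Lemma lin_spanP A (S : set A) (a : K) x y :
  lin_span S x -> lin_span S y -> lin_span S (a *: x + y).
Proof.
move=> [m [b [v [Sv ->]]]] [n [c [w [Sw ->]]]].
exists (m + n)%N,
  (fun i => match fintype.split i with inl i => a * b i | inr i => c i end),
  (fun i => match fintype.split i with inl i => v i | inr i => w i end).
split=> [i|]; first by case: (fintype.split i).
rewrite big_split_ord scaler_sumr /=; congr (_ + _); apply: eq_bigr => i _.
  by rewrite (unsplitK (inl i : 'I_m + 'I_n)%type) scalerA.
by rewrite (unsplitK (inr i : 'I_m + 'I_n)%type).
Qed.

Lemma spin_operator_system A (u : nat -> A) :
  spin_relations u -> operator_system (spin_system u).
Proof.
move=> [su _ _].
have star0 : star (0 : A) = 0 by apply: (addrI (star 0)); rewrite -starD !addr0.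
have star1 : star (1 : A) = 1.
  by rewrite -[star 1]mulr1 -{2}(starK 1) -starM mulr1 starK.
split=> [|a x y|x [n [a [v [Sv ->]]]]].
- by apply: lin_span_sub; left.
- exact: lin_spanP.
exists n, (fun i => (a i)^*), v; split=> //.
rewrite (big_morph _ (@starD _ A) star0); apply: eq_bigr => i _.
by rewrite starZ; congr (_ *: _); case: (Sv i) => [->//|[k _ <-]].
Qed.

Lemma closure_operator_system A (S : set A) :
  operator_system S -> operator_system (closure S).
Proof.
move=> [S1 Slin Sstar].
have clP (x : A) : closure S x <->
    forall e : K, 0 < e -> exists2 y, S y & `|x - y| < e.
  split=> [cx e e0|cx N /nbhs_ballP[e /= e0 eN]].
    by have [y [Sy]] := cx _ (nbhsx_ballx x e e0); rewrite -ball_normE; exists y.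
  by have [y Sy xy] := cx e e0; exists y; split=> //; apply: eN; rewrite -ball_normE.
split=> [|a x y /clP cx /clP cy|x /clP cx]; first exact: subset_closure.
- apply/clP => e e0.
  have na : 0 < `|a| + 1 by rewrite ltr_wpDl.
  have [x' Sx' xx'] := cx (e / 2 / (`|a| + 1)) ltac:(by rewrite !divr_gt0).
  have [y' Sy' yy'] := cy (e / 2) ltac:(by rewrite divr_gt0).
  exists (a *: x' + y'); first exact: Slin.
  rewrite opprD addrACA -scalerBr (le_lt_trans (ler_normD _ _)) //.
  rewrite [e]splitr ler_ltD // normrZ.
  rewrite (@le_trans _ _ ((`|a| + 1) * `|x - x'|)) ?ler_wpM2r ?lerDl //.
  by rewrite mulrC -ler_pdivlMr // ltW.
apply/clP => e e0; have [y Sy xy] := cx e e0.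
exists (star y); first exact: Sstar.
have starB : star (x - y) = star x - star y.
  by rewrite starD -scaleN1r starZ rmorphN1 scaleN1r.
by rewrite -starB star_norm.
Qed.

End CStarAlgebras.

(* Main.v *)
Require Import Defs.
From HB Require Import structures.
From mathcomp Require Import all_boot all_order all_algebra.
From mathcomp Require Import all_classical all_reals all_analysis.
From mathcomp Require Import complex mxtens.

(** Let [A] be the universal algebra of the spin system [u].  Its generators
    give, by the Jordan-Wigner transformation, pairwise commuting pairs of
    anticommuting selfadjoint unitaries (Pauli pairs), hence commuting systems
    of 2 x 2 matrix units, hence compatible unital *-homomorphisms from the
    tensor powers of [M_2] to [A]; conversely the Pauli pairs recover [u], so
    that [A] is the closure of the union of these matrix algebras
    ([spin_generated_tensor], [universal_spin_infinite_tensor]).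

    A matrix algebra carries only one C*-norm ([mx_starhom_norm_le]) and
    *-homomorphisms of C*-algebras are contractive ([starhom_contractive]).
    Thus every unital *-homomorphism out of an infinite tensor power of [M_2]
    is isometric on a dense subset, hence everywhere: in particular [A] is
    simple ([starhom_limit_isometric]).

    Both isomorphisms follow.  The operator systems under consideration
    generate [A], and the inclusion of each of them in [A] is a complete order
    embedding.  The universal property of the C*-envelope [E] therefore gives
    a surjective *-homomorphism from [A] to [E], which is injective because
    [A] is simple: both envelopes are isomorphic to [A]
    ([cstar_envelope_isomorphic]).  If [T] is any infinite tensor power of
    [M_2], the Pauli matrices of its tensor factors produce, by the inverse
    Jordan-Wigner transformation, a spin system in [T]; universality of [A]
    gives a *-homomorphism from [A] to [T], which is isometric and has dense,
    hence full, range ([universal_spin_isomorphic]). *)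

Import Order.TTheory GRing.Theory Num.Theory.
Import numFieldNormedType.Exports.

Local Open Scope classical_set_scope.
Local Open Scope ring_scope.

(** * Norm estimates in C*-algebras *)
Section General.
Context {K : numClosedFieldType}.
Implicit Types A B : cstarAlgType K.

Lemma star0 A : star (0 : A) = 0.
Proof. by apply: (addrI (star 0)); rewrite -starD !addr0. Qed.

Lemma star1 A : star (1 : A) = 1.
Proof. by rewrite -[star 1]mulr1 -{2}(starK 1) -starM mulr1 starK. Qed.

Lemma starN A (x : A) : star (- x) = - star x.
Proof. by rewrite -scaleN1r starZ rmorphN1 scaleN1r. Qed.

Lemma starB A (x y : A) : star (x - y) = star x - star y.
Proof. by rewrite starD starN. Qed.

Lemma cstar_norm1 A : `|1 : A| = 1 :> K.
Proof.
have n0 : `|1 : A| != 0 :> K by rewrite normr_eq0 oner_eq0.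
apply: (mulfI n0); rewrite mulr1 -expr2 -cstar_norm star1 mul1r //.
Qed.

Lemma half_add A (x : A) : 2^-1 *: (x + x) = x.
Proof. by rewrite -mulr2n -[x *+ 2]scaler_nat scalerA mulVf ?pnatr_eq0 // scale1r. Qed.

Lemma closureP A (S : set A) (x : A) :
  closure S x <-> forall e : K, 0 < e -> exists2 y, S y & `|x - y| < e.
Proof.
split=> [cx e e0|cx N /nbhs_ballP[e /= e0 eN]].
  by have [y [Sy]] := cx _ (nbhsx_ballx x e e0); rewrite -ball_normE; exists y.
by have [y Sy xy] := cx e e0; exists y; split=> //; apply: eN; rewrite -ball_normE.
Qed.

(** Identities that hold along a convergent sequence pass to the limit.  Only
    a Lipschitz bound at the limit point is required, so that this also
    applies to maps that are not globally Lipschitz. *)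
Lemma eq_closure A B (f g : A -> B) (C : K) (S : set A) (l : A) :
  0 <= C -> closure S l ->
  (forall x, S x -> `|f x - f l| <= C * `|x - l|) ->
  (forall x, S x -> `|g x - g l| <= C * `|x - l|) ->
  (forall x, S x -> f x = g x) -> f l = g l.
Proof.
move=> C0 /closureP Sl fL gL fg; apply/eqP; rewrite -subr_eq0 -normr_eq0 eq_le.
rewrite normr_ge0 andbT; apply/ler_addgt0Pr => e e0; rewrite add0r.
have D0 : 0 < C + C + 1 by rewrite ltr_wpDl ?addr_ge0.
have [x Sx xl] := Sl (e / (C + C + 1)) ltac:(by rewrite divr_gt0).
have -> : f l - g l = - (f x - f l) + (g x - g l).
  by rewrite -(fg x Sx) opprB subrKA.
rewrite (le_trans (ler_normD _ _)) //.
rewrite normrN (le_trans (lerD (fL x Sx) (gL x Sx))) // -mulrDl.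
rewrite distrC in xl; rewrite (@le_trans _ _ ((C + C + 1) * `|x - l|)) //.
  by rewrite ler_wpM2r // lerDl.
by rewrite mulrC -ler_pdivlMr // ltW.
Qed.

Lemma cauchy_limit A (x_ : nat -> A) :
  (forall e : K, 0 < e -> exists N, forall n, (N <= n)%N -> `|x_ n - x_ N| < e) ->
  exists l, forall e : K, 0 < e ->
    exists N, forall n, (N <= n)%N -> `|l - x_ n| < e.
Proof.
move=> xC.
have [l xl] : exists l : A, x_ @ \oo --> l.
  suff xl : cauchy (x_ @ \oo).
    by exists (lim (x_ @ \oo)); exact: cauchy_cvg.
  suff : cauchy_ex (x_ @ \oo) by exact: cauchy_exP.
  move=> e /xC[N NP]; exists (x_ N); exists N => // n /= /NP.
  by rewrite -ball_normE /= distrC.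
exists l => e e0; have /cvgrPdist_lt/(_ _ e0)[N _ NP] := xl.
by exists N => n /NP.
Qed.

(** The element [w = k + i s] satisfies [w^* w = c^2], so its norm is [c], and
    [k] is the half-sum of [w] and [w^*]. *)
Lemma norm_le_of_unitary_dilation A (k s : A) (c : K) : 0 <= c ->
  star k = k -> star s = s -> s * k = k * s ->
  k * k + s * s = (c ^+ 2)%:A -> `|k| <= c.
Proof.
move=> c0 sk ss sC ks; pose w := k + 'i *: s.
have sw : star w = k - 'i *: s by rewrite starD starZ sk ss conjCi scaleNr.
have nw : `|w| = c.
  apply/eqP; rewrite -(@eqrXn2 _ 2) // -cstar_norm sw mulrDl mulNr !mulrDr.
  rewrite -!scalerAl -!scalerAr sC scalerA -(expr2 'i) sqrCi opprD addrA addrK.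
  rewrite scaleN1r opprK ks normrZ cstar_norm1 mulr1 ger0_norm ?exprn_ge0 //.
have -> : k = 2^-1 *: (w + star w).
  by rewrite sw addrACA subrr addr0 half_add.
rewrite normrZ ger0_norm ?invr_ge0 // mulrC ler_pdivrMr //.
by rewrite (le_trans (ler_normD _ _)) // star_norm nw mulr_natr mulr2n.
Qed.

End General.

(** * Square roots and contractivity of *-homomorphisms *)
Section Analysis.
Context {R : realType}.
Local Notation K := R[i].
Implicit Types A B : cstarAlgType K.

(** The order of [R[i]] is partial, but a positive element is real, so the
    archimedean property of [R] applies. *)
Lemma exprn_lt (a e : K) : 0 <= a -> a < 1 -> 0 < e ->
  exists N, forall n, (N <= n)%N -> a ^+ n < e.
Proof.
case: a => a a'; rewrite lecE /= => /andP[/eqP-> a0].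
rewrite ltcE /= eqxx => a1.
case: e => e e'; rewrite ltcE /= => /andP[/eqP-> e0].
have na : `|a| < 1 by rewrite ger0_norm.
have /cvgrPdist_lt/(_ _ e0) := cvg_geometric 1 na.
move=> [N _ NP]; exists N => n /NP /=; rewrite sub0r normrN /geometric /= mul1r.
rewrite ger0_norm ?exprn_ge0 // -[(a +i* 0)%C]/(a%:C)%C -[(e +i* 0)%C]/(e%:C)%C.
by rewrite -rmorphXn ltcR.
Qed.

Lemma geometric_cauchy_limit A (x_ : nat -> A) (a C : K) :
  0 <= a -> a < 1 -> 0 <= C ->
  (forall n k, `|x_ (n + k)%N - x_ n| <= C * a ^+ n) ->
  exists l, forall e, 0 < e ->
    exists N, forall n, (N <= n)%N -> `|l - x_ n| < e.
Proof.
move=> a0 a1 C0 xC; apply: cauchy_limit => e e0.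
have D0 : 0 < C + 1 by rewrite ltr_wpDl.
have [N NP] := exprn_lt a (e / (C + 1)) a0 a1 ltac:(by rewrite divr_gt0).
exists N => n Nn.
have := xC N (n - N)%N; rewrite subnKC // => /le_lt_trans; apply.
rewrite (@le_lt_trans _ _ ((C + 1) * a ^+ N)) //.
  by rewrite ler_wpM2r ?exprn_ge0 // lerDl.
by rewrite mulrC -ltr_pdivlMr // NP.
Qed.

(** The square root is [1 - x], for [x] the fixed point of
    [F : x |-> (h^2 + x^2) / 2].  On the ball of radius [`|h|] the map [F] is
    [`|h|]-Lipschitz, so the iterates of [F] from [0] converge; they are
    selfadjoint and commute with [h], and so does their limit.  This replaces
    the continuous functional calculus. *)
Lemma cstar_sqrt A (h : A) : star h = h -> `|h| < 1 ->
  exists s, [/\ star s = s, s * h = h * s & s * s = 1 - h * h].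
Proof.
move=> sh h1; pose F (x : A) := 2^-1 *: (h * h + x * x) : A.
have FB (x y : A) : F x - F y = 2^-1 *: (x * (x - y) + (x - y) * y).
  rewrite /F -scalerBr mulrBr mulrBl subrKA opprD addrACA subrr add0r //.
have n2 (x : A) : `|2^-1 *: x| = 2^-1 * `|x|.
  by rewrite normrZ ger0_norm // invr_ge0.
have FL (x y : A) : `|x| <= `|h| -> `|y| <= `|h| -> `|F x - F y| <= `|h| * `|x - y|.
  move=> xh yh; rewrite FB n2 mulrC ler_pdivrMr //.
  rewrite (le_trans (ler_normD _ _)) // mulr_natr mulr2n.
  rewrite lerD // (le_trans (cstar_normM _ _)) // ?ler_wpM2r //.
  by rewrite mulrC ler_wpM2r.
pose x_ n := iter n F 0.
have xh n : `|x_ n| <= `|h|.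
  elim: n => [|n IH]; first by rewrite normr0.
  rewrite /x_ /= -/(x_ n) /F n2 mulrC ler_pdivrMr // mulr_natr mulr2n.
  rewrite (le_trans (ler_normD _ _)) // lerD // (le_trans (cstar_normM _ _)) //.
    by rewrite ler_piMr // ltW.
  by rewrite (le_trans (ler_pM _ _ IH IH)) // ler_piMr // ltW.
have xsh n : star (x_ n) = x_ n.
  elim: n => [|n IH]; first exact: star0.
  rewrite /x_ /= -/(x_ n) /F starZ starD !starM sh IH.
  by rewrite fmorphV /= rmorph_nat.
have xC n : x_ n * h = h * x_ n.
  elim: n => [|n IH]; first by rewrite mul0r mulr0.
  rewrite /x_ /= -/(x_ n) /F -scalerAl -scalerAr mulrDl mulrDr -!mulrA IH.
  by rewrite (mulrA (x_ n)) IH -!mulrA.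
(* [x_ (n + k)] and [x_ n] are the [n]-th iterates of [x_ k] and [0]. *)
have xCauchy n k : `|x_ (n + k)%N - x_ n| <= `|h| * `|h| ^+ n.
  rewrite mulrC; elim: n k => [|n IH] k; first by rewrite subr0 mul1r.
  rewrite addSn /x_ /= -/(x_ n) -/(x_ (n + k)%N).
  by rewrite exprS -mulrA (le_trans (FL _ _ _ _)) // ler_wpM2l.
have [l lP] := geometric_cauchy_limit A x_ _ _ (normr_ge0 h) h1 (normr_ge0 h) xCauchy.
have cl : closure (range x_) l.
  by apply/closureP => e /lP[N NP]; exists (x_ N); [exists N|exact: NP].
have sl : star l = l.
  apply: (eq_closure A A (@star _ A) id 1 (range x_)) => //.
  - by move=> x _; rewrite -starB star_norm mul1r.
  - by move=> x _; rewrite mul1r.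
  - by move=> _ [n _ <-].
have lC : l * h = h * l.
  apply: (eq_closure A A ( *%R^~ h) ( *%R h) `|h| (range x_)) => //.
  - by move=> x _; rewrite -mulrBl mulrC (cstar_normM _ _).
  - by move=> x _; rewrite -mulrBr (cstar_normM _ _).
  - by move=> _ [n _ <-].
have lh : `|l| <= `|h|.
  apply/ler_addgt0Pl => e /lP[N NP].
  rewrite -(subrK (x_ N) l) (le_trans (ler_normD _ _)) // lerD //.
  exact/ltW/NP.
have lF : F l = l.
  apply/eqP; rewrite -subr_eq0 -normr_eq0 eq_le normr_ge0 andbT.
  apply/ler_addgt0Pr => e e0; rewrite add0r.
  have [N NP] := lP (e / 2) ltac:(by rewrite divr_gt0).
  rewrite -(subrKA (x_ N.+1)) [e]splitr (le_trans (ler_normD _ _)) // lerD //.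
    rewrite (le_trans (FL _ _ _ _)) //.
    by rewrite (le_trans (ler_piMl _ _)) // ltW // NP.
  by rewrite distrC ltW // NP.
exists (1 - l); split; first by rewrite starB star1 sl.
  by rewrite mulrBl mulrBr lC mul1r mulr1.
have hl : l + l = h * h + l * l.
  by rewrite -{1 2}lF /F -scalerDr half_add.
by rewrite mulrBl mul1r mulrBr mulr1 -addrA -opprD addrA hl addrK.
Qed.

(** By the C*-identity it suffices to treat a selfadjoint [h], which may be
    scaled so that [`|h| < 1].  Then [1 - h^2] is the square of some [s]
    commuting with [h], and [f h + i f s] is a unitary whose real part is
    [f h]. *)
Lemma starhom_contractive A B (f : {lrmorphism A -> B}) :
  starhom f -> forall x, `|f x| <= `|x|.
Proof.
move=> sf.
suff sa : forall h : A, star h = h -> `|f h| <= `|h|.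
  move=> x; rewrite -(@ler_pXn2r _ 2) ?nnegrE // -!cstar_norm -sf -rmorphM.
  by rewrite sa // starM starK.
have scaled (c : K) (h : A) : star h = h -> `|h| < c -> `|f h| <= c.
  move=> sh hc; have c0 : 0 < c by apply: le_lt_trans hc.
  have cC : c^-1^* = c^-1 by apply/CrealP; rewrite realE invr_ge0 (ltW c0).
  have nc : `|c^-1| = c^-1 by rewrite ger0_norm // invr_ge0 ltW.
  have [||s [ss sC sq]] := cstar_sqrt _ (c^-1 *: h).
  - by rewrite starZ sh cC.
  - by rewrite normrZ nc mulrC ltr_pdivrMr // mul1r.
  have : `|f (c^-1 *: h)| <= 1.
    apply: (norm_le_of_unitary_dilation _ _ (f s)) => //.
    - by rewrite -sf starZ sh cC.
    - by rewrite -sf ss.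
    - by rewrite -!rmorphM sC.
    - by rewrite -!rmorphM sq -rmorphD addrC subrK rmorph1 expr1n scale1r.
  by rewrite linearZ normrZ nc mulrC ler_pdivrMr // mul1r.
move=> h sh; rewrite real_leNgt ?ger0_real //; apply/negP => lt.
(* The strict bound of [scaled] is applied at the midpoint of the two norms. *)
have [m1 m2] := midf_lt lt.
by have := scaled _ _ sh m1; rewrite real_leNgt ?m2 // ger0_real // ?divr_ge0 // addr_ge0.
Qed.

End Analysis.

(** * Uniqueness of the C*-norm on matrix algebras *)
Section MatrixNorm.
Context {K : numClosedFieldType}.
Implicit Types A B : cstarAlgType K.
Local Open Scope sesquilinear_scope.

Lemma mx_starhom0 A n (g : 'M[K]_n -> A) : mx_starhom g -> g 0 = 0.
Proof.
move=> [_ gL _ _]; have := gL 1 0 0; rewrite !scale1r add0r => g0.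
by apply: (addrI (g 0)); rewrite -g0 addr0.
Qed.

Lemma mx_starhomZ A n (g : 'M[K]_n -> A) :
  mx_starhom g -> forall a X, g (a *: X) = a *: g X.
Proof.
move=> gh a X; have [_ gL _ _] := gh; rewrite -[a *: X]addr0 gL.
by rewrite (mx_starhom0 _ _ g) // addr0.
Qed.

Lemma mx_starhomD A n (g : 'M[K]_n -> A) :
  mx_starhom g -> forall X Y, g (X + Y) = g X + g Y.
Proof. by move=> [_ gL _ _] X Y; have := gL 1 X Y; rewrite !scale1r. Qed.

Lemma mx_starhom_sum A n (g : 'M[K]_n -> A) (I : finType) (F : I -> 'M[K]_n) :
  mx_starhom g -> g (\sum_i F i) = \sum_i g (F i).
Proof.
move=> gh; exact: (big_morph g (mx_starhomD _ _ g gh) (mx_starhom0 _ _ g gh)).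
Qed.

Lemma mx_starhom_delta_neq0 A n (g : 'M[K]_n -> A) i :
  mx_starhom g -> g (delta_mx i i) != 0.
Proof.
move=> gh; have [g1 _ gM _] := gh.
apply: contra_not_neq (negP (oner_neq0 A)) => gi; apply/eqP.
rewrite -g1 mx1_sum_delta (mx_starhom_sum _ _ _ _ _ gh) big1 // => j _.
by rewrite -(mul_delta_mx i) -(mul_delta_mx i i) !gM gi mul0r mulr0.
Qed.

(** The image of the matrix unit [E_ii] is a nonzero element that
    [g (diag_mx d)] multiplies by [d_i]. *)
Lemma le_norm_mx_starhom_diag A n (g : 'M[K]_n -> A) (d : 'rV[K]_n) i :
  mx_starhom g -> `|d 0 i| <= `|g (diag_mx d)|.
Proof.
move=> gh; have [_ _ gM _] := gh.
have n0 : 0 < `|g (delta_mx i i)| by rewrite normr_gt0 (mx_starhom_delta_neq0 _ _ _ _ gh).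
rewrite -(ler_pM2r n0) -normrZ -(mx_starhomZ _ _ _ gh).
rewrite (le_trans _ (cstar_normM _ _)) // -gM.
suff -> : d 0 i *: delta_mx i i = diag_mx d *m delta_mx i i by [].
apply/matrixP => k l; rewrite mul_diag_mx !mxE.
by case: eqP => [->|] //=; rewrite !mulr0.
Qed.

(** The diagonal matrix with entries [sqrt (c^2 - d_i^2)] completes
    [diag_mx d] to [c] times a unitary. *)
Lemma norm_mx_starhom_diag_le A n (g : 'M[K]_n -> A) (d : 'rV[K]_n) (c : K) :
  mx_starhom g -> d \is a mxOver Num.real -> 0 <= c ->
  (forall i, `|d 0 i| <= c) -> `|g (diag_mx d)| <= c.
Proof.
move=> gh /mxOverP dR c0 dc; have [g1 _ gM gs] := gh.
pose s : 'rV[K]_n := \row_i sqrtC (c ^+ 2 - d 0 i ^+ 2).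
have sR i : s 0 i \is Num.real.
  rewrite mxE ger0_real // sqrtC_ge0 subr_ge0.
  by rewrite -(real_normK (dR 0 i)) lerXn2r ?nnegrE.
have diagS (e : 'rV[K]_n) : (forall i, e 0 i \is Num.real) ->
    star (g (diag_mx e)) = g (diag_mx e).
  move=> eR; rewrite -gs tr_diag_mx; congr g; apply/matrixP => i j.
  by rewrite !mxE; case: eqP => [->|_]; rewrite ?mulr1n ?mulr0n ?rmorph0 ?(CrealP (eR j)).
apply: (norm_le_of_unitary_dilation _ _ (g (diag_mx s))) => //.
- exact: diagS.
- exact: diagS.
- by rewrite -!gM diag_mxC.
rewrite -!gM -(mx_starhomD _ _ _ gh) -g1 -(mx_starhomZ _ _ _ gh); congr g.
apply/matrixP => i j; rewrite !mul_diag_mx !mxE.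
case: eqP => [->|_]; rewrite ?mulr1n ?mulr0n ?mulr0 ?addr0 // mulr1 -!expr2 sqrtCK.
by rewrite addrC subrK.
Qed.

Lemma mx_starhom_unitary_conj A n (g : 'M[K]_n -> A) (P X : 'M[K]_n) :
  mx_starhom g -> P \is unitarymx -> `|g (P^t* *m X *m P)| <= `|g X|.
Proof.
move=> gh /unitarymxP PP; have [g1 _ gM gs] := gh.
have PPC : P^t* *m P = 1%:M by exact: mulmx1C.
have nP : `|g P| <= 1.
  rewrite -(@ler_pXn2r _ 2) ?nnegrE // -cstar_norm -gs -gM PPC g1.
  by rewrite cstar_norm1 expr1n.
rewrite !gM gs (le_trans (cstar_normM _ _)) // -[leRHS]mulr1 ler_pM //.
rewrite (le_trans (cstar_normM _ _)) // star_norm.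
by rewrite -[leRHS]mul1r ler_wpM2r.
Qed.

(** By the C*-identity the matrix may be taken hermitian, and by the spectral
    theorem real diagonal; the norm of the image of a diagonal matrix is then
    the largest modulus of its entries, whatever the homomorphism. *)
Lemma mx_starhom_norm_le A B n (g : 'M[K]_n -> A) (h : 'M[K]_n -> B) X :
  mx_starhom g -> mx_starhom h -> `|h X| <= `|g X|.
Proof.
move=> gh hh; have [_ _ gM gs] := gh; have [_ _ hM hs] := hh.
rewrite -(@ler_pXn2r _ 2) ?nnegrE // -!cstar_norm -gs -hs -gM -hM.
set H := _ *m X.
have Hh : H \is hermsymmx.
  by apply/is_hermitianmxP; rewrite expr0 scale1r /H trmx_mul map_mxM -/(X^t*^t* ) trmxCK.
have /orthomx_spectralP HE := hermitian_normalmx Hh.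
have dR := hermitian_spectral_diag_real Hh.
have PU := spectral_unitarymx H.
move: (spectral_diag H) (spectralmx H) dR PU HE => d P dR PU HE.
have iP : invmx P = P^t*.
  exact: invmx_unitary.
have PP : P *m P^t* = 1%:M by apply/unitarymxP.
have DE : diag_mx d = P^t*^t* *m H *m P^t*.
  by rewrite trmxCK HE iP !mulmxA PP mul1mx -mulmxA PP mulmx1.
have PU' : P^t* \is unitarymx.
  by rewrite trmxC_unitary.
rewrite {1}HE iP (le_trans (mx_starhom_unitary_conj _ _ _ _ _ hh PU)) //.
rewrite (le_trans _ (_ : `|g (diag_mx d)| <= _)) //; last first.
  by rewrite DE (mx_starhom_unitary_conj _ _ _ _ _ gh PU').
apply: norm_mx_starhom_diag_le => // i.
exact: le_norm_mx_starhom_diag.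
Qed.

End MatrixNorm.

(** * The Jordan-Wigner transformation *)
Section JordanWigner.
Context {K : numClosedFieldType}.
Implicit Types A : cstarAlgType K.

(** Commutation ([b = false]) and anticommutation ([b = true]) are treated
    together: the sign of a product is the [addb] of the signs, which reduces
    the relations below to parity computations. *)
Definition sgcomm {A : cstarAlgType K} (b : bool) (x y : A) : Prop :=
  x * y = (-1) ^+ b *: (y * x).

Lemma sgcomm_sym A b (x y : A) : sgcomm b x y -> sgcomm b y x.
Proof. by rewrite /sgcomm => ->; rewrite scalerA -expr2 sqrr_sign scale1r. Qed.

Lemma sgcommMr A b c (x y z : A) :
  sgcomm b x y -> sgcomm c x z -> sgcomm (b (+) c) x (y * z).
Proof.
rewrite /sgcomm => xy xz; rewrite mulrA xy -scalerAl -(mulrA y x z) xz -scalerAr scalerA.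
by rewrite signr_addb mulrA.
Qed.

Lemma sgcommMl A b c (x y z : A) :
  sgcomm b x z -> sgcomm c y z -> sgcomm (b (+) c) (x * y) z.
Proof. by move=> xz yz; apply/sgcomm_sym/sgcommMr; apply/sgcomm_sym. Qed.

Lemma sgcommZr A b a (x y : A) : sgcomm b x y -> sgcomm b x (a *: y).
Proof.
by rewrite /sgcomm => xy; rewrite -scalerAr xy -scalerAl scalerA mulrC -scalerA.
Qed.

Lemma sgcommZl A b a (x y : A) : sgcomm b x y -> sgcomm b (a *: x) y.
Proof. by move=> xy; apply/sgcomm_sym/sgcommZr/sgcomm_sym. Qed.

Lemma sgcomm_refl A (x : A) : sgcomm false x x.
Proof. by rewrite /sgcomm expr0 scale1r. Qed.

Lemma sgcomm_false A (x y : A) : sgcomm false x y <-> x * y = y * x.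
Proof. by rewrite /sgcomm expr0 scale1r. Qed.

Lemma sgcomm_true A (x y : A) : sgcomm true x y <-> x * y + y * x = 0.
Proof.
rewrite /sgcomm expr1 scaleN1r; split=> [->|/eqP]; first by rewrite addNr.
by rewrite addr_eq0 => /eqP.
Qed.

(** The Jordan-Wigner string, the product of the parity operators of the first
    [n] sites. *)
Definition jw_string {A : cstarAlgType K} (Z : nat -> A) n : A := \prod_(k < n) Z k.

Lemma jw_stringS A (Z : nat -> A) n : jw_string Z n.+1 = jw_string Z n * Z n.
Proof. by rewrite /jw_string big_ord_recr. Qed.

Lemma sgcomm_jw_string A (Z : nat -> A) (b : pred nat) (x : A) n :
  (forall m, sgcomm (b m) (Z m) x) ->
  sgcomm (odd (\sum_(m < n) b m)) (jw_string Z n) x.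
Proof.
move=> Zx; elim: n => [|n IH].
  by rewrite /jw_string !big_ord0 /sgcomm mul1r mulr1 scale1r.
by rewrite jw_stringS big_ord_recr /= oddD oddb; apply: sgcommMl.
Qed.

(** The string of length [n] sees the site [m], and picks up its sign, exactly
    when [m < n]. *)
Lemma odd_sum_eq n m : odd (\sum_(k < n) (k == m :> nat)) = (m < n)%N.
Proof.
elim: n => [|n IH]; first by rewrite big_ord0.
rewrite big_ord_recr /= oddD IH oddb ltnS [in RHS]leq_eqVlt (eq_sym n).
by have [->|] := eqVneq m n; rewrite ?ltnn ?addbF.
Qed.

Section String.
Context {A : cstarAlgType K} (Z : nat -> A).
Hypotheses (ZC : forall n m, sgcomm false (Z n) (Z m))
  (ZS : forall n, star (Z n) = Z n) (ZZ : forall n, Z n * Z n = 1).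

Lemma jw_string_comm n m : sgcomm false (jw_string Z n) (Z m).
Proof.
by have := sgcomm_jw_string A Z xpred0 (Z m) n (ZC^~ m); rewrite big1.
Qed.

Lemma jw_string_commute n m : sgcomm false (jw_string Z n) (jw_string Z m).
Proof.
have := sgcomm_jw_string A Z xpred0 (jw_string Z m) n; rewrite big1 //; apply.
by move=> k; apply/sgcomm_sym/jw_string_comm.
Qed.

Lemma star_jw_string n : star (jw_string Z n) = jw_string Z n.
Proof.
elim: n => [|n IH]; first by rewrite /jw_string big_ord0 star1.
by rewrite jw_stringS starM IH ZS; apply/esym/sgcomm_false/jw_string_comm.
Qed.

Lemma jw_string_sq n : jw_string Z n * jw_string Z n = 1.
Proof.
elim: n => [|n IH]; first by rewrite /jw_string big_ord0 mulr1.
rewrite jw_stringS {1}((sgcomm_false _ _ _).1 (jw_string_comm n n)) mulrA.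
by rewrite -(mulrA (Z n)) IH mulr1 ZZ.
Qed.

End String.

(** The pair [(X n, Z n)] behaves as the Pauli matrices [sigma_x], [sigma_z] in
    the [n]-th factor of a tensor product. *)
Definition pauli_pairs {A : cstarAlgType K} (X Z : nat -> A) : Prop :=
  [/\ forall n, star (X n) = X n /\ star (Z n) = Z n,
      forall n, X n * X n = 1 /\ Z n * Z n = 1,
      forall n m, sgcomm false (X n) (X m),
      forall n m, sgcomm false (Z n) (Z m)
    & forall n m, sgcomm (n == m) (X n) (Z m)].

(** The site [n] carries the two spins of indices [2 n] and [2 n + 1]; the
    string turns the commutation of different sites into anticommutation. *)
Definition spin_of_pauli {A : cstarAlgType K} (X Z : nat -> A) k : A :=
  let n := k./2 in
  if odd k then 'i *: (jw_string Z n * X n * Z n) else jw_string Z n * X n.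

(** The inverse transformation: [Z n] is, up to a phase, the product of the two
    spins of the site [n], and [X n] is the first one without its string. *)
Definition pauliZ {A : cstarAlgType K} (u : nat -> A) n : A :=
  - 'i *: (u n.*2 * u n.*2.+1).
Definition pauliX {A : cstarAlgType K} (u : nat -> A) n : A :=
  jw_string (pauliZ u) n * u n.*2.

Section PauliToSpin.
Context {A : cstarAlgType K} (X Z : nat -> A).
Hypothesis XZ : pauli_pairs X Z.
Let P := jw_string Z.
Let v n := P n * X n.

Let ZC n m : sgcomm false (Z n) (Z m). Proof. by case: XZ. Qed.
Let ZS n : star (Z n) = Z n. Proof. by case: XZ => /(_ n)[]. Qed.
Let ZZ n : Z n * Z n = 1. Proof. by case: XZ => _ /(_ n)[]. Qed.
Let XC n m : sgcomm false (X n) (X m). Proof. by case: XZ. Qed.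
Let XS n : star (X n) = X n. Proof. by case: XZ => /(_ n)[]. Qed.
Let XX n : X n * X n = 1. Proof. by case: XZ => _ /(_ n)[]. Qed.
Let XZC n m : sgcomm (n == m) (X n) (Z m). Proof. by case: XZ. Qed.

Let PX n m : sgcomm (m < n)%N (P n) (X m).
Proof.
rewrite -odd_sum_eq; apply: (sgcomm_jw_string _ _ (fun k => k == m)) => k.
by rewrite eq_sym; apply/sgcomm_sym/XZC.
Qed.

Let vZ n m : sgcomm (n == m) (v n) (Z m).
Proof. by apply: (sgcommMl _ false); [apply: jw_string_comm|apply: XZC]. Qed.

Let vv n m : sgcomm (n != m) (v n) (v m).
Proof.
have -> : (n != m) = (false (+) (m < n)%N) (+) ((n < m)%N (+) false).
  by case: ltngtP.
apply: sgcommMl; apply: sgcommMr => //; first exact: jw_string_commute.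
exact/sgcomm_sym/PX.
Qed.

Let star_v n : star (v n) = v n.
Proof.
rewrite starM XS star_jw_string //; apply/esym/sgcomm_false.
by have := PX n n; rewrite ltnn.
Qed.

Let v_sq n : v n * v n = 1.
Proof.
have /sgcomm_false PXn : sgcomm false (P n) (X n) by have := PX n n; rewrite ltnn.
by rewrite /v {1}PXn mulrA -(mulrA (X n)) jw_string_sq // mulr1 XX.
Qed.

Lemma spin_of_pauli_relations : spin_relations (spin_of_pauli X Z).
Proof.
split=> [k|k|i j ij]; rewrite ?/spin_of_pauli -/P -?/(v _).
- case: ifP => _; rewrite // starZ starM star_v ZS conjCi.
  by rewrite -/(v _) (vZ k./2 k./2) eqxx expr1 scaleN1r scalerN scaleNr.
- case: ifP => _; rewrite -/(v _) expr2 // -scalerAl -scalerAr scalerA -(expr2 'i) sqrCi.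
  move: (k./2) => n; rewrite mulrA -(mulrA (v n) (Z n) (v n)).
  rewrite (sgcomm_sym _ _ _ _ (vZ n n)) eqxx expr1.
  rewrite -scalerAr -scalerAl scalerA mulrNN mulr1 scale1r.
  by rewrite (mulrA (v _)) v_sq mul1r ZZ.
apply/sgcomm_true; rewrite -!/(v _).
have vw n m : sgcomm true (v n) (v m * Z m).
  by rewrite -[true]/(~~ false) -(addbb (n == m)) -addNb; apply: sgcommMr.
have := odd_double_half i; have := odd_double_half j.
move: ij; case: (odd i); case: (odd j) => /= ij Ej Ei.
- apply/sgcommZl/sgcommZr.
  have -> : true = ((i./2 != j./2) (+) (i./2 == j./2)) (+) ((j./2 == i./2) (+) false).
    by rewrite (eq_sym j./2); case: eqP => // ijh; rewrite -Ei -Ej ijh eqxx in ij.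
  by apply: sgcommMl; apply: sgcommMr => //; apply/sgcomm_sym.
- exact/sgcommZl/sgcomm_sym.
- exact/sgcommZr.
have -> : true = (i./2 != j./2).
  by apply/esym; apply: contraNneq ij => ijh; rewrite -Ei -Ej ijh.
exact: vv.
Qed.

Lemma pauliZ_spin_of_pauli n : pauliZ (spin_of_pauli X Z) n = Z n.
Proof.
rewrite /pauliZ /spin_of_pauli /= odd_double uphalf_double doubleK /= -/P -/(v n).
rewrite -scalerAr scalerA mulNr -expr2 sqrCi opprK scale1r mulrA v_sq mul1r //.
Qed.

Lemma pauliX_spin_of_pauli n : pauliX (spin_of_pauli X Z) n = X n.
Proof.
rewrite /pauliX (_ : pauliZ _ = Z); last exact/funext/pauliZ_spin_of_pauli.
rewrite /spin_of_pauli odd_double doubleK mulrA jw_string_sq // mul1r //.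
Qed.
End PauliToSpin.

Section SpinToPauli.
Context {A : cstarAlgType K} (u : nat -> A).
Hypothesis hu : spin_relations u.
Let X := pauliX u.
Let Z := pauliZ u.
Let P := jw_string Z.

Let uS k : star (u k) = u k. Proof. by case: hu. Qed.
Let u_sq k : u k * u k = 1. Proof. by case: hu => _ + _; apply. Qed.
Let uu i j : sgcomm (i != j) (u i) (u j).
Proof.
have [->|ij] := eqVneq i j; first exact: sgcomm_refl.
by apply/sgcomm_true; case: hu => _ _; apply.
Qed.

Let Zu n k : sgcomm (n == k./2) (Z n) (u k).
Proof.
apply: sgcommZl.
have -> : (n == k./2) = (n.*2 != k) (+) (n.*2.+1 != k); last exact: sgcommMl.
rewrite -{2 3}(odd_double_half k); case: (odd k); rewrite ?add1n ?add0n.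
  rewrite eqSS (inj_eq double_inj) (_ : n.*2 == _ = false) ?addTb ?negbK //.
  by apply/eqP => /(congr1 odd); rewrite /= !odd_double.
rewrite (inj_eq double_inj) (_ : n.*2.+1 == _ = false) ?addbT ?negbK //.
by apply/eqP => /(congr1 odd); rewrite /= !odd_double.
Qed.

Let ZC n m : sgcomm false (Z n) (Z m).
Proof.
rewrite -(addbb (n == m)); apply/sgcommZr/sgcommMr.
  by have := Zu n m.*2; rewrite doubleK.
by have := Zu n m.*2.+1; rewrite /= uphalf_double.
Qed.

Let ZS n : star (Z n) = Z n.
Proof.
rewrite starZ starM !uS rmorphN /= conjCi opprK (uu n.*2.+1 n.*2).
by rewrite gtn_eqF // expr1 scalerA mulrN1.
Qed.

Let ZZ n : Z n * Z n = 1.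
Proof.
have VU : u n.*2.+1 * u n.*2 = -1 *: (u n.*2 * u n.*2.+1).
  by rewrite (uu n.*2.+1 n.*2) gtn_eqF.
rewrite /Z /pauliZ -scalerAl -scalerAr scalerA mulrNN -(expr2 'i) sqrCi.
rewrite mulrA -(mulrA (u n.*2) (u n.*2.+1) (u n.*2)) VU.
rewrite -scalerAr -scalerAl scalerA mulrNN mulr1 scale1r.
by rewrite (mulrA (u n.*2)) u_sq mul1r u_sq.
Qed.

Let Pu n k : sgcomm (k./2 < n)%N (P n) (u k).
Proof.
by rewrite -odd_sum_eq; apply: (sgcomm_jw_string _ _ (fun m => m == k./2)).
Qed.

Let PC n m : sgcomm false (P n) (P m).
Proof. exact: (jw_string_commute _ ZC). Qed.

Lemma pauli_of_spin : pauli_pairs X Z.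
Proof.
split=> // [n|n|n m|n m].
- split=> //; rewrite starM uS star_jw_string //; apply/esym/sgcomm_false.
  by have := Pu n n.*2; rewrite doubleK ltnn.
- split=> //; rewrite /X /pauliX -/P.
  have /sgcomm_false PuC : sgcomm false (P n) (u n.*2).
    by have := Pu n n.*2; rewrite doubleK ltnn.
  by rewrite {1}PuC mulrA -(mulrA (u _)) jw_string_sq // mulr1 u_sq.
- have -> : false = (false (+) (m < n)%N) (+) ((n < m)%N (+) (n != m)).
    by case: ltngtP.
  apply: sgcommMl; apply: sgcommMr => //.
  + by have := Pu n m.*2; rewrite doubleK.
  + by apply: sgcomm_sym; have := Pu m n.*2; rewrite doubleK.
  + by rewrite -(inj_eq double_inj).
apply: (sgcommMl _ false); first exact: jw_string_comm.
by apply: sgcomm_sym; have := Zu m n.*2; rewrite doubleK eq_sym.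
Qed.

Lemma spin_of_pauli_of_spin : spin_of_pauli X Z = u.
Proof.
apply/funext => k; rewrite /spin_of_pauli /X /pauliX -/Z mulrA jw_string_sq // mul1r.
rewrite -[in RHS](odd_double_half k); case: (odd k) => //.
by rewrite /Z /pauliZ -scalerAr scalerA mulrN -expr2 sqrCi opprK scale1r mulrA u_sq mul1r.
Qed.

End SpinToPauli.

End JordanWigner.

(** * Commuting matrix units and tensor powers of M_2 *)
Section TensorMap.
Context {K : numClosedFieldType}.
Implicit Types A B : cstarAlgType K.
Local Open Scope sesquilinear_scope.

Definition matrix_units {A : cstarAlgType K} (e : nat -> 'I_2 -> 'I_2 -> A) : Prop :=
  [/\ forall n k l, star (e n k l) = e n l k,
      forall n k l p q, e n k l * e n p q = (l == p)%:R *: e n k q,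
      forall n, \sum_k e n k k = 1
    & forall n m k l p q, n != m -> e n k l * e m p q = e m p q * e n k l].

(** A matrix of [M_m (x) M_2] is seen as a 2 x 2 matrix with blocks in [M_m];
    [tblock m M k l] is the coefficient of the matrix unit [E_kl] of [M_2]. *)
Definition tblock m (M : 'M[K]_(m * 2)) (k l : 'I_2) : 'M[K]_m :=
  \matrix_(a, b) M (mxtens_index (a, k)) (mxtens_index (b, l)).

(** The homomorphism that sends the matrix unit [E_kl] of the [m]-th tensor
    factor to [e m k l]. *)
Fixpoint tensor_map {A : cstarAlgType K} (e : nat -> 'I_2 -> 'I_2 -> A) n :
    'M[K]_(tdim n) -> A :=
  match n with
  | 0 => fun M => M 0 0 *: 1
  | m.+1 => fun M => \sum_k \sum_l tensor_map e m (tblock (tdim m) M k l) * e m k l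
  end.

Lemma big_mxtens_index (V : nmodType) m n (F : 'I_(m * n) -> V) :
  \sum_i F i = \sum_a \sum_b F (mxtens_index (a, b)).
Proof.
rewrite pair_big /= (reindex (@mxtens_index m n)) /=.
  by apply: eq_bigr => -[].
by exists (@mxtens_unindex m n) => i _; rewrite (mxtens_indexK, mxtens_unindexK).
Qed.

Lemma tblockL m a (M N : 'M[K]_(m * 2)) k l :
  tblock m (a *: M + N) k l = a *: tblock m M k l + tblock m N k l.
Proof. by apply/matrixP => i j; rewrite !mxE. Qed.

Lemma tblockM m (M N : 'M[K]_(m * 2)) k l :
  tblock m (M *m N) k l = \sum_p tblock m M k p *m tblock m N p l.
Proof.
apply/matrixP => i j; rewrite !mxE big_mxtens_index exchange_big summxE /=.
by apply: eq_bigr => p _; rewrite mxE; apply: eq_bigr => a _; rewrite !mxE.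
Qed.

Lemma tblock_adj m (M : 'M[K]_(m * 2)) k l : tblock m (M^t*) k l = (tblock m M l k)^t*.
Proof. by apply/matrixP => i j; rewrite !mxE. Qed.

Lemma tblock_tens m (M : 'M[K]_m) (N : 'M[K]_2) k l : tblock m (M *t N) k l = N k l *: M.
Proof. by apply/matrixP => i j; rewrite !mxE !mxtens_indexK mulrC. Qed.

Lemma tblock1 m k l : tblock m 1%:M k l = (k == l)%:R *: 1%:M.
Proof.
apply/matrixP => i j; rewrite !mxE (can_eq (@mxtens_indexK _ _)) xpair_eqE.
by rewrite mulr_natr -mulrnA mulnb andbC.
Qed.

Lemma tblock_sum m (M : 'M[K]_(m * 2)) :
  M = \sum_k \sum_l tblock m M k l *t delta_mx k l.
Proof.
apply/matrixP => i j; case: (mxtens_indexP i) => a k; case: (mxtens_indexP j) => b l.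
rewrite summxE (bigD1 k) //= summxE (bigD1 l) //= tensmxE !mxE !eqxx mulr1.
rewrite !big1 ?addr0 // => [k' kk|l' ll].
  rewrite summxE big1 // => l' _; rewrite tensmxE !mxE eq_sym (negPf kk) mulr0 //.
by rewrite tensmxE !mxE eqxx eq_sym (negPf ll) mulr0.
Qed.

Section Units.
Context {A : cstarAlgType K} (e : nat -> 'I_2 -> 'I_2 -> A).
Hypothesis he : matrix_units e.
Local Notation j := (tensor_map e).

Lemma tensor_mapL n a (M N : 'M[K]_(tdim n)) : j n (a *: M + N) = a *: j n M + j n N.
Proof.
elim: n a M N => [|n IH] a M N /=; first by rewrite !mxE scalerDl scalerA.
rewrite scaler_sumr -big_split; apply: eq_bigr => k _ /=.
rewrite scaler_sumr -big_split; apply: eq_bigr => l _ /=.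
by rewrite tblockL IH mulrDl scalerAl.
Qed.

Let j0 n : j n 0 = 0.
Proof.
have := tensor_mapL n 1 0 0; rewrite !scale1r add0r => /esym/eqP.
by rewrite -subr_eq0 addrK => /eqP.
Qed.

Let jZ n a (M : 'M[K]_(tdim n)) : j n (a *: M) = a *: j n M.
Proof. by rewrite -[a *: M]addr0 tensor_mapL j0 addr0. Qed.

Let jD n (M N : 'M[K]_(tdim n)) : j n (M + N) = j n M + j n N.
Proof. by have := tensor_mapL n 1 M N; rewrite !scale1r. Qed.

Let j_sum n (I : finType) (F : I -> 'M[K]_(tdim n)) : j n (\sum_i F i) = \sum_i j n (F i).
Proof. exact: (big_morph _ (jD n) (j0 n)). Qed.

Lemma tensor_map_comm n (M : 'M[K]_(tdim n)) (x : A) :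
  (forall m k l, (m < n)%N -> x * e m k l = e m k l * x) -> x * j n M = j n M * x.
Proof.
elim: n M => [|n IH] M xe /=; first by rewrite -scalerAl -scalerAr mulr1 mul1r.
rewrite mulr_sumr mulr_suml; apply: eq_bigr => k _.
rewrite mulr_sumr mulr_suml; apply: eq_bigr => l _.
rewrite mulrA IH; last by move=> m p q mn; rewrite xe // ltnS ltnW.
by rewrite -!mulrA xe.
Qed.

Let je n (M : 'M[K]_(tdim n)) k l : e n k l * j n M = j n M * e n k l.
Proof.
by apply: tensor_map_comm => m p q mn; case: he => _ _ _; apply; rewrite gtn_eqF.
Qed.

Lemma tensor_map_tens n (M : 'M[K]_(tdim n)) (N : 'M[K]_2) :
  j n.+1 (M *t N) = j n M * \sum_k \sum_l N k l *: e n k l.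
Proof.
rewrite /= mulr_sumr; apply: eq_bigr => k _; rewrite mulr_sumr; apply: eq_bigr => l _.
by rewrite tblock_tens jZ -scalerAl -scalerAr.
Qed.

Lemma tensor_map_starhom n : mx_starhom (j n).
Proof.
have [es em e1 _] := he.
split; [|exact: tensor_mapL| |].
- elim: n => [|n IH]; first by rewrite /= mxE scale1r.
  rewrite /= -(e1 n); apply: eq_bigr => k _; rewrite (bigD1 k) //= big1 => [|l lk].
    by rewrite tblock1 eqxx scale1r IH mul1r addr0.
  by rewrite tblock1 eq_sym (negPf lk) scale0r j0 mul0r.
- elim: n => [|n IH] M N.
    by rewrite /= mxE big_ord1 -scalerAl -scalerAr mul1r scalerA.
  rewrite /= mulr_suml; apply: eq_bigr => k _.
  transitivity (\sum_p \sum_l (j n (tblock (tdim n) M k p) * e n k p) *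
     (j n (tblock (tdim n) N p l) * e n p l)).
    rewrite exchange_big; apply: eq_bigr => l _ /=.
    rewrite tblockM j_sum mulr_suml; apply: eq_bigr => p _.
    rewrite IH -!mulrA; congr (_ * _); rewrite mulrA je -mulrA em eqxx scale1r //.
  rewrite mulr_suml; apply: eq_bigr => p _; rewrite mulr_sumr.
  rewrite [RHS](bigD1 p) //= [X in _ + X]big1 ?addr0 => [|q qp].
    by rewrite mulr_sumr.
  rewrite mulr_sumr big1 // => l _; rewrite -!mulrA (mulrA (e _ _ _)) je -mulrA em.
  by rewrite eq_sym (negPf qp) scale0r !mulr0.
elim: n => [|n IH] M; first by rewrite /= !mxE starZ star1.
rewrite [RHS](big_morph _ (@starD _ A) (star0 A)) [LHS]exchange_big.
apply: eq_bigr => l _; rewrite [RHS](big_morph _ (@starD _ A) (star0 A)).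
apply: eq_bigr => k _.
by rewrite tblock_adj starM es -IH je.
Qed.

Lemma tensor_map_compat n (M : 'M[K]_(tdim n)) :
  j n.+1 (M *t (1%:M : 'M[K]_2)) = j n M.
Proof.
have [_ _ e1 _] := he.
rewrite tensor_map_tens -[RHS]mulr1 -(e1 n); congr (_ * _); apply: eq_bigr => k _.
rewrite (bigD1 k) //= big1 ?addr0 => [|l lk]; first by rewrite mxE eqxx scale1r.
by rewrite mxE eq_sym (negPf lk) scale0r.
Qed.

End Units.

(** A matrix is the sum over [k] and [l] of its blocks tensored with [E_kl], so
    a compatible family of homomorphisms is determined by the images of the
    matrix units of each factor. *)
Lemma tensor_map_unique A (g : forall n, 'M[K]_(tdim n) -> A) :
  (forall n, mx_starhom (g n)) ->
  (forall n (M : 'M[K]_(tdim n)), g n.+1 (M *t (1%:M : 'M[K]_2)) = g n M) ->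
  forall n M, tensor_map (fun m k l => g m.+1 (1%:M *t delta_mx k l)) n M = g n M.
Proof.
move=> gh gc; elim=> [|n IH] M /=.
  have [g1 _ _ _] := gh 0%N; rewrite -g1 -(mx_starhomZ _ _ _ (gh 0%N)); congr (g 0%N).
  by apply/matrixP => i k; rewrite !ord1 !mxE mulr1.
have [_ _ gM _] := gh n.+1.
rewrite [in RHS](tblock_sum _ M).
rewrite (mx_starhom_sum _ _ _ _ _ (gh n.+1)); apply: eq_bigr => k _.
rewrite (mx_starhom_sum _ _ _ _ _ (gh n.+1)); apply: eq_bigr => l _.
by rewrite IH -gc -gM tensmx_mul mulmx1 mul1mx.
Qed.

Lemma rmorph_tensor_map A B (f : {lrmorphism A -> B}) e n M :
  f (tensor_map e n M) = tensor_map (fun m k l => f (e m k l)) n M.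
Proof.
elim: n M => [|n IH] M /=; first by rewrite linearZ rmorph1.
rewrite linear_sum; apply: eq_bigr => k _; rewrite linear_sum; apply: eq_bigr => l _.
by rewrite rmorphM -IH.
Qed.

End TensorMap.

(** * Matrix units from Pauli pairs *)
Section PauliUnits.
Context {K : numClosedFieldType}.
Implicit Types A B : cstarAlgType K.

(** [(1 + Z n) / 2] is the rank one projection [E_00] of the [n]-th factor, and
    [X n] exchanges the two basis vectors. *)
Definition pauli_unit {A : cstarAlgType K} (X Z : nat -> A) n (k l : 'I_2) : A :=
  X n ^+ k * (2^-1 *: (1 + Z n)) * X n ^+ l.

Lemma comm_scale A a (x y : A) : GRing.comm x y -> GRing.comm x (a *: y).
Proof. by rewrite /GRing.comm -scalerAl -scalerAr => ->. Qed.

Section Units.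
Context {A : cstarAlgType K} (X Z : nat -> A).
Hypothesis hXZ : pauli_pairs X Z.
Let p n : A := 2^-1 *: (1 + Z n).
Local Notation e := (pauli_unit X Z).

Let XX n : X n * X n = 1. Proof. by case: hXZ => _ /(_ n)[]. Qed.
Let ZZ n : Z n * Z n = 1. Proof. by case: hXZ => _ /(_ n)[]. Qed.
Let XZX n : X n * Z n * X n = - Z n.
Proof.
case: hXZ => _ _ _ _ /(_ n n) ->.
by rewrite eqxx expr1 -scalerAl -mulrA XX mulr1 scaleN1r.
Qed.

Let pp n : p n * p n = p n.
Proof.
rewrite /p -scalerAl -scalerAr; congr (_ *: _).
rewrite mulrDl mul1r mulrDr mulr1 ZZ [Z n + 1]addrC half_add //.
Qed.

Let XpX n : X n * p n * X n = 1 - p n.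
Proof.
rewrite /p -scalerAr -scalerAl mulrDr mulrDl mulr1 XX XZX.
apply/eqP; rewrite eq_sym subr_eq -scalerDr addrACA addNr addr0 half_add //.
Qed.

Let pXp n : p n * X n * p n = 0.
Proof.
have -> : p n * X n * p n = p n * (X n * p n * X n) * X n.
  by rewrite -!mulrA XX mulr1.
by rewrite XpX mulrBr mulr1 pp subrr mul0r.
Qed.

Lemma pauli_matrix_units : matrix_units e.
Proof.
have [XZS _ XC ZC XZC] := hXZ.
have starX n k : star (X n ^+ k) = X n ^+ k.
  elim: k => [|k IH]; first by rewrite expr0 star1.
  by rewrite exprSr starM IH (XZS n).1 -exprS exprSr.
have star_p n : star (p n) = p n.
  by rewrite starZ starD star1 (XZS n).2 fmorphV /= rmorph_nat.
split=> [n k l|n k l a b|n|n m k l a b nm].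
- by rewrite /pauli_unit -/(p n) !starM !starX star_p mulrA.
- rewrite /pauli_unit -/(p n).
  have -> : X n ^+ k * p n * X n ^+ l * (X n ^+ a * p n * X n ^+ b)
          = X n ^+ k * (p n * (X n ^+ l * X n ^+ a) * p n) * X n ^+ b.
    by rewrite !mulrA.
  suff -> : p n * (X n ^+ l * X n ^+ a) * p n = (l == a)%:R *: p n.
    by rewrite -scalerAr -scalerAl.
  case: l a => -[|[|//]] ? [[|[|//]] ?] /=; rewrite ?expr1 ?expr0 ?mul1r ?mulr1.
  + by rewrite pp scale1r.
  + by rewrite pXp scale0r.
  + by rewrite pXp scale0r.
  + by rewrite XX mulr1 pp scale1r.
- rewrite big_ord_recl big_ord1 /pauli_unit -/(p n) /= expr0 mul1r mulr1 expr1.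
  by rewrite XpX addrC subrK.
have XXc : GRing.comm (X n) (X m) by apply/sgcomm_false.
have ZZc : GRing.comm (Z n) (Z m) by apply/sgcomm_false.
have XZc : GRing.comm (X n) (Z m) by apply/sgcomm_false; rewrite -(negbTE nm).
have ZXc : GRing.comm (Z n) (X m).
  by apply/sgcomm_false/sgcomm_sym; have := XZC m n; rewrite eq_sym (negbTE nm).
have ce x : GRing.comm x (X m) -> GRing.comm x (Z m) -> GRing.comm x (e m a b).
  move=> xX xZ; apply: commrM; last exact: commrX.
  by apply: commrM; [exact: commrX|apply/comm_scale/commrD => //; exact: commr1].
suff : GRing.comm (e m a b) (e n k l) by move/esym.
have eX := commr_sym (ce _ XXc XZc); have eZ := commr_sym (ce _ ZXc ZZc).
apply: commrM; last exact: commrX.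
by apply: commrM; [exact: commrX|apply/comm_scale/commrD => //; exact: commr1].
Qed.

Definition sigmaX : 'M[K]_2 := \matrix_(k, l) (k != l)%:R.
Definition sigmaZ : 'M[K]_2 := \matrix_(k, l) ((-1) ^+ k *+ (k == l)).

Lemma pauli_unit_X n : \sum_k \sum_l sigmaX k l *: e n k l = X n.
Proof.
rewrite !big_ord_recl !big_ord0 !mxE /= !scale0r !scale1r !addr0 add0r.
rewrite /pauli_unit -/(p n) /= expr0 expr1 mul1r mulr1.
have -> : X n * p n = X n - p n * X n.
  by rewrite -[LHS]mulr1 -(XX n) mulrA XpX mulrBl mul1r.
by rewrite addrC subrK.
Qed.

Lemma pauli_unit_Z n : \sum_k \sum_l sigmaZ k l *: e n k l = Z n.
Proof.
rewrite !big_ord_recl !big_ord0 !mxE /= !scale0r !addr0 add0r.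
rewrite /pauli_unit -/(p n) /= expr0 expr1 mul1r mulr1 scale1r XpX scaleN1r opprB addrA.
by rewrite -scalerDr half_add addrAC subrr add0r.
Qed.

End Units.
End PauliUnits.

(** * Dense unions of matrix algebras *)
Section InductiveLimit.
Context {K : numClosedFieldType}.
Implicit Types A B : cstarAlgType K.

(** Matrix algebras are simple: compressing [X] by matrix units isolates each
    of its entries. *)
Lemma mx_starhom_inj A n (g : 'M[K]_n -> A) : mx_starhom g -> injective g.
Proof.
move=> gh; suff g0 X : g X = 0 -> X = 0.
  move=> X Y gXY; apply/eqP; rewrite -subr_eq0; apply/eqP/g0.
  by have [_ gL _ _] := gh; rewrite addrC -scaleN1r gL gXY scaleN1r addNr.
move=> gX; apply/matrixP => i j; rewrite mxE.
have [_ _ gM _] := gh.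
have : g (delta_mx i i *m X *m delta_mx j i) = 0 by rewrite !gM gX mulr0 mul0r.
have -> : delta_mx i i *m X *m delta_mx j i = X i j *: delta_mx i i.
  apply/matrixP => k l; rewrite !mxE (bigD1 j) //= big1 => [|m mj]; last first.
    by rewrite [X in _ * X]mxE (negPf mj) mulr0.
  rewrite !mxE (bigD1 i) //= big1 => [|m mi]; last first.
    by rewrite mxE (negPf mi) andbF mul0r.
  rewrite !mxE !eqxx !andbT !addr0 /=.
  by do 2 case: eqP => _; rewrite ?mul1r ?mulr1 ?mul0r ?mulr0.
move/eqP; rewrite (mx_starhomZ _ _ _ gh) scaler_eq0.
rewrite (negPf (mx_starhom_delta_neq0 _ _ _ _ gh)).
by rewrite orbF => /eqP.
Qed.

Lemma closure_mono A (S S' : set A) : S `<=` S' -> closure S `<=` closure S'.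
Proof. by move=> SS x /closureP Sx; apply/closureP => e /Sx[y /SS]; exists y. Qed.

Lemma closure_lipschitz A B (f : A -> B) (C : K) (S : set A) (S' : set B) :
  0 <= C -> (forall x y, `|f x - f y| <= C * `|x - y|) ->
  (forall x, S x -> closure S' (f x)) -> forall l, closure S l -> closure S' (f l).
Proof.
move=> C0 fL fS l /closureP Sl; apply/closureP => e e0.
have D0 : 0 < C + 1 by rewrite ltr_wpDl.
have [x Sx lx] := Sl (e / 2 / (C + 1)) ltac:(by rewrite !divr_gt0).
have /closureP/(_ (e / 2))[|y S'y xy] := fS x Sx; first by rewrite divr_gt0.
exists y => //; rewrite -(subrKA (f x)) (le_lt_trans (ler_normD _ _)) //.
rewrite [e]splitr ler_ltD // (le_trans (fL _ _)) //.
rewrite (@le_trans _ _ ((C + 1) * `|l - x|)) ?ler_wpM2r ?lerDl //.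
by rewrite mulrC -ler_pdivlMr // ltW.
Qed.

(** For the products, the closure is entered in one variable at a time, so that
    the other one provides a fixed Lipschitz constant. *)
Lemma closure_cstar_subalgebra A (S : set A) : operator_system S ->
  (forall x y, S x -> S y -> S (x * y)) -> cstar_subalgebra (closure S).
Proof.
move=> oS SM; have [S1 SL Ss] := closure_operator_system oS.
split=> //; first exact: closed_closure.
have half x y : S x -> closure S y -> closure S (x * y).
  move=> Sx; apply: (closure_lipschitz _ _ ( *%R x) `|x| S) => // [y' y''|y' Sy'].
    by rewrite -mulrBr cstar_normM.
  by apply: subset_closure; apply: SM.
move=> x y Sx Sy; move: x Sx.
apply: (closure_lipschitz _ _ ( *%R^~ y) `|y| S) => // [x x'|x Sx]; last exact: half.
by rewrite -mulrBl mulrC cstar_normM.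
Qed.

Lemma cstar_generates_mono A (S S' : set A) :
  S `<=` S' -> cstar_generates S -> cstar_generates S'.
Proof. by move=> SS gS D Dsub S'D; apply: gS => // x /SS /S'D. Qed.

Lemma mx_starhom_range_mono A (j : forall n, 'M[K]_(tdim n) -> A) :
  (forall n (X : 'M[K]_(tdim n)), j n.+1 (X *t (1%:M : 'M[K]_2)) = j n X) ->
  forall n m, (n <= m)%N -> range (j n) `<=` range (j m).
Proof.
move=> jc n m /subnK <-; elim: (m - n)%N => [//|k IH] x /IH[M _ <-].
by exists (M *t 1%:M); rewrite // jc.
Qed.

Lemma union_subalgebra A (j : forall n, 'M[K]_(tdim n) -> A) :
  (forall n, mx_starhom (j n)) ->
  (forall n (X : 'M[K]_(tdim n)), j n.+1 (X *t (1%:M : 'M[K]_2)) = j n X) ->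
  cstar_subalgebra (closure (\bigcup_n range (j n))).
Proof.
move=> jh jc.
have both x y : (\bigcup_n range (j n)) x -> (\bigcup_n range (j n)) y ->
    exists n X Y, x = j n X /\ y = j n Y.
  move=> [n _ nx] [m _ my]; exists (maxn n m).
  have [X _ <-] := mx_starhom_range_mono _ _ jc _ _ (leq_maxl n m) _ nx.
  have [Y _ <-] := mx_starhom_range_mono _ _ jc _ _ (leq_maxr n m) _ my.
  by exists X, Y.
apply: closure_cstar_subalgebra => [|x y xU yU]; last first.
  have [n [X [Y [-> ->]]]] := both _ _ xU yU; exists n => //; exists (X *m Y) => //.
  by have [_ _ -> _] := jh n.
split=> [|a x y xU yU|x [n _ [X _ <-]]].
- by exists 0%N => //; exists 1%:M => //; have [-> _ _ _] := jh 0%N.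
- have [n [X [Y [-> ->]]]] := both _ _ xU yU; exists n => //; exists (a *: X + Y) => //.
  by have [_ -> _ _] := jh n.
by exists n => //; exists (map_mx Num.conj X^T) => //; have [_ _ _ ->] := jh n.
Qed.

Lemma cstar_subalgebra_jw_string A (D : set A) Z n : cstar_subalgebra D ->
  (forall k, D (Z k)) -> D (jw_string Z n).
Proof.
move=> [_ D1 _ DM _] DZ; elim: n => [|n IH]; first by rewrite /jw_string big_ord0.
by rewrite jw_stringS; apply: DM.
Qed.

Lemma cstar_subalgebra_spin A (D : set A) X Z k : cstar_subalgebra D ->
  (forall n, D (X n)) -> (forall n, D (Z n)) -> D (spin_of_pauli X Z k).
Proof.
move=> Dsub DX DZ; have [_ D1 DL DM _] := Dsub.
have D0 : D 0 by rewrite -(addNr 1) -scaleN1r; apply: DL.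
have DPX : D (jw_string Z k./2 * X k./2).
  by apply: DM => //; apply: cstar_subalgebra_jw_string.
rewrite /spin_of_pauli; case: ifP => // _; rewrite -[_ *: _]addr0.
by apply: DL => //; apply: DM.
Qed.

(** The closure of the union of the matrix algebras is a C*-subalgebra.  It
    contains the Pauli pairs, hence the spins obtained from them, which are the
    generators [u]. *)
Lemma spin_generated_tensor A (u : nat -> A) :
  spin_relations u -> cstar_generates (range u) ->
  let e := pauli_unit (pauliX u) (pauliZ u) in
  [/\ forall n, mx_starhom (tensor_map e n),
   forall n (X : 'M[K]_(tdim n)),
     tensor_map e n.+1 (X *t (1%:M : 'M[K]_2)) = tensor_map e n X
   & closure (\bigcup_n range (tensor_map e n)) = setT].
Proof.
move=> hu gu e; have hXZ := pauli_of_spin _ hu.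
have he : matrix_units e by apply: pauli_matrix_units.
have jh n := tensor_map_starhom e he n.
have jc n M := tensor_map_compat e he n M.
split=> //; apply: gu; first exact: union_subalgebra.
have jU (S : 'M[K]_2) n :
    (\bigcup_m range (tensor_map e m)) (\sum_k \sum_l S k l *: e n k l).
  exists n.+1 => //; exists (1%:M *t S) => //.
  by rewrite tensor_map_tens //; have [-> _ _ _] := jh n; rewrite mul1r.
move=> _ [k _ <-]; rewrite -(spin_of_pauli_of_spin _ hu).
apply: cstar_subalgebra_spin; first exact: union_subalgebra.
  by move=> n; apply: subset_closure; rewrite -(pauli_unit_X _ _ hXZ); apply: jU.
by move=> n; apply: subset_closure; rewrite -(pauli_unit_Z _ _ hXZ); apply: jU.
Qed.

Section Limit.
Context {A : cstarAlgType K} (j : forall n, 'M[K]_(tdim n) -> A).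
Hypotheses (jh : forall n, mx_starhom (j n))
  (jc : forall n (X : 'M[K]_(tdim n)), j n.+1 (X *t (1%:M : 'M[K]_2)) = j n X).
Let s n (M : 'M[K]_2) : A := j n.+1 (1%:M *t M).

Let sM n M N : s n M * s n N = s n (M *m N).
Proof. by have [_ _ jM _] := jh n.+1; rewrite /s -jM tensmx_mul mulmx1. Qed.

Let s1 n : s n 1%:M = 1.
Proof. by rewrite /s jc; have [-> _ _ _] := jh n. Qed.

Let sL n a M N : s n (a *: M + N) = a *: s n M + s n N.
Proof.
have [_ jL _ _] := jh n.+1; rewrite /s -jL; congr (j _ _).
by apply/matrixP => k l; rewrite !mxE mulrDr mulrCA.
Qed.

Let s_star n M : star (s n M) = s n (map_mx Num.conj M^T).
Proof.
have [_ _ _ js] := jh n.+1; rewrite /s -js; congr (j n.+1 _).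
by rewrite trmx_tens map_mxT trmx1 map_mx1.
Qed.

Let s_comm n m M N : n != m -> s n M * s m N = s m N * s n M.
Proof.
wlog : n m M N / (n < m)%N => [H nm|nm _].
  have [/H->//|mn|/eqP] := ltngtP n m; last by rewrite (negPf nm).
  by apply/esym/H => //; rewrite eq_sym.
have [X _ Xs] : range (j m) (s n M).
  by apply: (mx_starhom_range_mono _ _ jc _ _ nm); exists (1%:M *t M).
have [_ _ jM _] := jh m.+1.
by rewrite -Xs -jc /s -!jM !tensmx_mul !mulmx1 !mul1mx.
Qed.

Let sXX : sigmaX *m sigmaX = 1%:M :> 'M[K]_2.
Proof.
apply/matrixP => -[[|[|//]] ?] [[|[|//]] ?]; rewrite !mxE !big_ord_recl big_ord0 !mxE /=.
all: by rewrite ?(mulr0, mulr1, addr0, add0r).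
Qed.

Let sZZ : sigmaZ *m sigmaZ = 1%:M :> 'M[K]_2.
Proof.
apply/matrixP => -[[|[|//]] ?] [[|[|//]] ?]; rewrite !mxE !big_ord_recl big_ord0 !mxE /=.
all: by rewrite ?(mulr0, mul0r, mulr1, addr0, add0r, mulrNN).
Qed.

Let sXZ : sigmaX *m sigmaZ = -1 *: (sigmaZ *m sigmaX) :> 'M[K]_2.
Proof.
apply/matrixP => -[[|[|//]] ?] [[|[|//]] ?]; rewrite !mxE !big_ord_recl !big_ord0 !mxE /=.
all: by rewrite ?(mulr0, mul0r, mulr1, mul1r, addr0, add0r, mulrNN).
Qed.

Let sXs : map_mx Num.conj sigmaX^T = sigmaX :> 'M[K]_2.
Proof. by apply/matrixP => k l; rewrite !mxE eq_sym rmorph_nat. Qed.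

Let sZs : map_mx Num.conj sigmaZ^T = sigmaZ :> 'M[K]_2.
Proof.
apply/matrixP => k l; rewrite !mxE eq_sym rmorphMn /= rmorphXn rmorphN1 /=.
by case: eqP => // ->.
Qed.

Let sZ a n M : s n (a *: M) = a *: s n M.
Proof.
have s0 : s n 0 = 0.
  have := sL n 1 0 0; rewrite !scale1r add0r => /esym/eqP.
  by rewrite -subr_eq0 addrK => /eqP.
by rewrite -[a *: M]addr0 sL s0 addr0.
Qed.

(** The factors of index [n < m] commute because the [n]-th one lies in the
    image of the first [m] factors, tensored with the identity of the
    [m]-th. *)
Lemma limit_pauli_pairs : pauli_pairs (s^~ sigmaX) (s^~ sigmaZ).
Proof.
split=> [n|n|n m|n m|n m].
- by rewrite !s_star sXs sZs.
- by rewrite !sM sXX sZZ s1.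
- by apply/sgcomm_false; have [->//|nm] := eqVneq n m; apply: s_comm.
- by apply/sgcomm_false; have [->//|nm] := eqVneq n m; apply: s_comm.
have [->|nm] := eqVneq n m; last by apply/sgcomm_false; apply: s_comm.
by rewrite /sgcomm expr1 !sM sXZ sZ.
Qed.

Let sigma_unit (k l : 'I_2) :
  sigmaX ^+ k *m (2^-1 *: (1%:M + sigmaZ)) *m sigmaX ^+ l = delta_mx k l :> 'M[K]_2.
Proof.
have -> : 2^-1 *: (1%:M + sigmaZ) = delta_mx 0 0 :> 'M[K]_2.
  apply/matrixP => -[[|[|//]] ?] [[|[|//]] ?]; rewrite !mxE /= ?addr0 ?mulr0 //.
    by rewrite mulVf // pnatr_eq0.
  by rewrite subrr mulr0.
case: k l => -[|[|//]] ? [[|[|//]] ?]; rewrite /= ?expr0 ?expr1 ?mul1mx ?mulmx1.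
all: apply/matrixP => -[[|[|//]] ?] [[|[|//]] ?].
all: rewrite !mxE ?big_ord_recl ?big_ord0 ?mxE /=.
all: rewrite ?big_ord_recl ?big_ord0 ?mxE /=.
all: by rewrite ?(mulr0, mul0r, mulr1, mul1r, addr0, add0r, mulrNN).
Qed.

Lemma limit_pauli_unit n k l :
  pauli_unit (s^~ sigmaX) (s^~ sigmaZ) n k l = s n (delta_mx k l).
Proof.
rewrite -sigma_unit.
have sX m : s n (sigmaX ^+ m) = s n sigmaX ^+ m.
  elim: m => [|m IH]; first by rewrite !expr0 s1.
  by rewrite !exprS -IH sM.
rewrite -!sM !sX sZ /pauli_unit; congr (_ * (_ *: _) * _).
by have := sL n 1 1%:M sigmaZ; rewrite !scale1r s1.
Qed.

End Limit.
End InductiveLimit.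

(** * Isomorphisms *)
Section Isomorphisms.
Context {R : realType}.
Local Notation K := R[i].
Implicit Types A B E : cstarAlgType K.

(** Preimages of a sequence converging to [y] form a Cauchy sequence, as [f]
    preserves distances. *)
Lemma isometric_range_closed A B (f : {lrmorphism A -> B}) :
  (forall x, `|f x| = `|x|) -> forall y, closure (range f) y -> exists x, f x = y.
Proof.
move=> fN y /closureP yR.
have h0 : 0 < 2^-1 :> K by rewrite invr_gt0.
have h1 : 2^-1 < 1 :> K by rewrite invf_lt1 // ltr1n.
have /choice[x_ xy] : forall n, exists x, `|y - f x| < 2^-1 ^+ n.
  by move=> n; have [_ [x _ <-] yx] := yR (2^-1 ^+ n) (exprn_gt0 _ h0); exists x.
have [e e0|l lP] := cauchy_limit _ x_.
  have [N NP] := exprn_lt _ (e / 2) (ltW h0) h1 ltac:(by rewrite divr_gt0).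
  exists N => n Nn; rewrite -fN raddfB -(subrKA y) (le_lt_trans (ler_normD _ _)) //.
  rewrite [e]splitr ltrD //; last exact: lt_trans (xy _) (NP _ _).
  by rewrite distrC (lt_trans (xy _)) // NP.
exists l; apply/eqP; rewrite -subr_eq0 -normr_eq0 eq_le normr_ge0 andbT.
apply/ler_addgt0Pr => e e0; rewrite add0r.
have [N NP] := exprn_lt _ (e / 2) (ltW h0) h1 ltac:(by rewrite divr_gt0).
have [M MP] := lP (e / 2) ltac:(by rewrite divr_gt0).
rewrite -(subrKA (f (x_ (maxn N M)))) (le_trans (ler_normD _ _)) //.
rewrite [e]splitr lerD // ltW //.
  by rewrite -raddfB fN MP // leq_maxr.
by rewrite distrC (lt_trans (xy _)) // NP // leq_maxl.
Qed.

(** The composites of [f] with the embeddings of the matrix algebras induce the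
    same norm as these embeddings, so [f] is isometric on a dense subset, and
    it is continuous because it is contractive. *)
Lemma starhom_limit_isometric A B (f : {lrmorphism A -> B}) :
  infinite_tensor_M2 A -> starhom f -> forall x, `|f x| = `|x|.
Proof.
move=> [j [jh _ _ jd]] sf x; apply/eqP; rewrite eq_le starhom_contractive //=.
apply/ler_addgt0Pr => e e0.
have /closureP/(_ (e / 2)) : closure (\bigcup_n range (j n)) x by rewrite jd.
move=> [|_ [n _ [X _ <-]] xX]; first by rewrite divr_gt0.
have jfh : mx_starhom (fun M => f (j n M)).
  have [j1 jL jM js] := jh n; split=> [|a M N|M N|M].
  - by rewrite j1 rmorph1.
  - by rewrite jL linearP.
  - by rewrite jM rmorphM.
  - by rewrite js sf.
have fjx : `|f (j n X)| <= e / 2 + `|f x|.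
  rewrite -(subrK (f x) (f (j n X))) -raddfB (le_trans (ler_normD _ _)) // lerD2r.
  by rewrite (le_trans (starhom_contractive _ _ _ sf _)) // distrC ltW.
rewrite -(subrK (j n X) x) (le_trans (ler_normD _ _)) // subrK addrC.
have jX := le_trans (mx_starhom_norm_le _ _ _ _ _ X jfh (jh n)) fjx.
by rewrite (le_trans (lerD jX (ltW xX))) // addrAC -splitr addrC.
Qed.

Lemma isometric_isomorphic A B (f : {lrmorphism A -> B}) : starhom f ->
  (forall x, `|f x| = `|x|) -> (forall y, exists x, f x = y) -> cstar_isomorphic A B.
Proof.
move=> sf fN /choice[g fg]; exists f => //; exists g => // x.
by apply/eqP; rewrite -subr_eq0 -normr_eq0 -fN raddfB /= fg subrr normr0.
Qed.

Lemma cstar_isomorphic_sym A B : cstar_isomorphic A B -> cstar_isomorphic B A.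
Proof.
move=> [f sf [g fK gK]].
pose g' : {lrmorphism B -> A} := HB.pack g
  (GRing.isLinear.Build _ _ _ _ g (can2_linear fK gK))
  (GRing.isMonoidMorphism.Build _ _ g (can2_monoid_morphism fK gK)).
exists g'; last by exists f.
by move=> x /=; rewrite -{1}(gK x) -sf fK.
Qed.

Lemma cstar_isomorphic_trans A B E :
  cstar_isomorphic A B -> cstar_isomorphic B E -> cstar_isomorphic A E.
Proof.
move=> [f sf fB] [g sg gB]; exists (g \o f : {lrmorphism A -> E}).
  by move=> x /=; rewrite sf sg.
exact: bij_comp.
Qed.

Lemma id_complete_order_embedding A (S : set A) : complete_order_embedding S (@id A).
Proof. by split=> // n X _; rewrite map_mx_id. Qed.

(** The identity of [A] is a competitor in the universal property of the
    envelope, and the resulting surjection is isometric. *)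
Lemma cstar_envelope_isomorphic A (S : set A) E (iota : A -> E) :
  infinite_tensor_M2 A -> cstar_generates S -> cstar_envelope S iota ->
  cstar_isomorphic A E.
Proof.
move=> hA gS [_ _ /(_ A id (id_complete_order_embedding A S))].
rewrite image_id => /(_ gS)[f [sf fS _]].
exact: isometric_isomorphic sf (starhom_limit_isometric _ _ _ hA sf) fS.
Qed.

Lemma universal_spin_infinite_tensor A (u : nat -> A) :
  universal_spin_algebra u -> infinite_tensor_M2 A.
Proof.
move=> [hu gu _]; have [jh jc jd] := spin_generated_tensor _ _ hu gu.
exists (tensor_map (pauli_unit (pauliX u) (pauliZ u))); split=> // n.
exact: mx_starhom_inj.
Qed.

(** The homomorphism [f] given by universality matches the Pauli pairs of [A]
    with those of [B], hence the matrix units, hence the embedded matrix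
    algebras; so its closed range contains a dense subset. *)
Lemma universal_spin_isomorphic A (u : nat -> A) B :
  universal_spin_algebra u -> infinite_tensor_M2 B -> cstar_isomorphic A B.
Proof.
move=> hu [j [jh _ jc jd]]; have hA := universal_spin_infinite_tensor _ _ hu.
have [_ _ uni] := hu.
have hXZ := limit_pauli_pairs _ jh jc.
set X : nat -> B := fun n => _ in hXZ; set Z : nat -> B := fun n => _ in hXZ.
have [f sf fu] := uni _ _ (spin_of_pauli_relations _ _ hXZ).
have fN := starhom_limit_isometric _ _ _ hA sf.
apply: (isometric_isomorphic _ _ _ sf fN) => y; apply: isometric_range_closed => //.
suff : \bigcup_n range (j n) `<=` range f.
  by move=> /closure_mono; apply; rewrite jd.
have fZ n : f (pauliZ u n) = Z n.
  by rewrite -(pauliZ_spin_of_pauli _ _ hXZ) /pauliZ linearZ rmorphM /= !fu.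
have fs n : f (jw_string (pauliZ u) n) = jw_string Z n.
  elim: n => [|n IH]; first by rewrite /jw_string !big_ord0 rmorph1.
  by rewrite !jw_stringS rmorphM /= IH fZ.
have fX n : f (pauliX u n) = X n.
  rewrite -(pauliX_spin_of_pauli _ _ hXZ) {1}/pauliX rmorphM /= fs fu /pauliX.
  by congr (jw_string _ _ * _); apply/funext => m; rewrite (pauliZ_spin_of_pauli _ _ hXZ).
move=> _ [n _ [M _ <-]].
rewrite -(tensor_map_unique _ j jh jc).
exists (tensor_map (pauli_unit (pauliX u) (pauliZ u)) n M) => //.
rewrite rmorph_tensor_map; congr (tensor_map _ n M).
apply/funext => m; apply/funext => k; apply/funext => l.
rewrite -(limit_pauli_unit _ jh jc) /pauli_unit.
by rewrite !rmorphM /= !rmorphXn /= linearZ /= rmorphD rmorph1 /= fX fZ.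
Qed.

End Isomorphisms.

Theorem theorem6p2 (R : realType)
    (A : cstarAlgType R[i]) (u : nat -> A) (hu : universal_spin_algebra u)
    (T : cstarAlgType R[i]) (hT : infinite_tensor_M2 T)
    (E1 : cstarAlgType R[i]) (iota1 : A -> E1)
    (hE1 : cstar_envelope (spin_system u) iota1)
    (E2 : cstarAlgType R[i]) (iota2 : A -> E2)
    (hE2 : cstar_envelope (closure (spin_system u)) iota2) :
  cstar_isomorphic E1 E2 /\ cstar_isomorphic E2 T.
Proof.
have hA := universal_spin_infinite_tensor _ _ hu.
have [_ gu _] := hu.
have uS : range u `<=` spin_system u.
  by move=> x ux; apply: lin_span_sub; right.
have gS := cstar_generates_mono _ _ _ uS gu.
have gS' := cstar_generates_mono _ _ _ (@subset_closure _ (spin_system u)) gS.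
have AE1 := cstar_envelope_isomorphic _ _ _ _ hA gS hE1.
have AE2 := cstar_envelope_isomorphic _ _ _ _ hA gS' hE2.
have E2A := cstar_isomorphic_sym _ _ AE2.
split; first exact: cstar_isomorphic_trans (cstar_isomorphic_sym _ _ AE1) AE2.
exact: cstar_isomorphic_trans E2A (universal_spin_isomorphic _ _ _ hu hT).
Qed.
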